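(* For every CBPV term $P$ and every CFG machine state $s$ that is well-formed with respect to $P$, $$\mathrm{CBPV.step}\,(\mathrm{unload}\;P\;s)\;=\;\mathrm{unload}\;P\;(\mathrm{CFG.step}\,(\mathrm{compile}\;P)\;s).$$ Both step functions are partial; the equation means that either both sides are undefined, or both are defined and are equal CBPV terms (up to renaming of bound variables).
   Context: **CBPV terms.** Values $V::= x\mid n\mid \mathsf{thunk}\,M$ ($x$ a variable, $n\in\mathbb N$). Terms $M,N::=\mathsf{force}\,V\mid \mathsf{letrec}\;x_1=M_1,\dots,x_m=M_m\;\mathsf{in}\;N\mid \mathsf{prd}\,V\mid M\;\mathsf{to}\;x\;\mathsf{in}\;N\mid V\cdot M\mid \lambda x.M\mid V_1\oplus V_2\mid \mathsf{if0}\;V\;M_1\;M_2$. Here $\oplus$ ranges over binary arithmetic operators, each with a fixed interpretation $[\![\oplus]\!]:\mathbb N\times\mathbb N\to\mathbb N$. The variables $x_1,\dots,x_m$ of a letrec are distinct and bound in $N$ and in all $M_i$; $x$ is bound in $N$ in $M\;\mathsf{to}\;x\;\mathsf{in}\;N$ and in $M$ in $\lambda x.M$. Terms may be open. $\{V/x\}N$ is capture-avoiding substitution (simultaneous for several variables). **CBPV.step.** The relation $\leadsto$ is inductively defined by: $M\leadsto M$; and $\mathsf{letrec}\;\overline{x_i=M_i}\;\mathsf{in}\;N\leadsto N'$ if $\{\mathsf{thunk}(\mathsf{letrec}\;\overline{x_i=M_i}\;\mathsf{in}\;M_j)/x_j\}_{j=1..m}N\leadsto N'$. The relation $\to$ is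 inductively defined by: $\mathsf{force}(\mathsf{thunk}\,M)\to M$; $M\;\mathsf{to}\;x\;\mathsf{in}\;N\to\{V/x\}N$ if $M\leadsto\mathsf{prd}\,V$; $V\cdot M\to\{V/x\}N$ if $M\leadsto\lambda x.N$; $M\;\mathsf{to}\;x\;\mathsf{in}\;N\to M'\;\mathsf{to}\;x\;\mathsf{in}\;N$ if $M\to M'$; $V\cdot M\to V\cdot M'$ if $M\to M'$; $N\to M$ if $N\leadsto N'$ and $N'\to M$; $M\;\mathsf{to}\;x\;\mathsf{in}\;N\to\{(n_1[\![\oplus]\!]n_2)/x\}N$ if $M\leadsto n_1\oplus n_2$; $\mathsf{if0}\;0\;M_1\;M_2\to M_1$; $\mathsf{if0}\;n\;M_1\;M_2\to M_2$ if $n\ne0$. This relation is deterministic, and $\mathrm{CBPV.step}$ is the corresponding partial function. **Paths.** A path is a finite list of naturals, $\cdot$ or $n::p$. Fix a term $P$. $P[\cdot]=P$, and $P[n::p]$ is the $n$-th immediate subterm of $P[p]$ (partial). Subterm numbering: the unique subterm of $\mathsf{thunk}\,M$, $\mathsf{force}\,V$, $\mathsf{prd}\,V$, $\lambda x.M$ is number $0$; in $M\;\mathsf{to}\;x\;\mathsf{in}\;N$, $M$ is $0$ and $N$ is $1$; in $V\cdot M$, $V$ is $0$ and $M$ is $1$; in $V_1\oplus V_2$ they are $0,1$; in $\mathsf{if0}\;V\;M_1\;M_2$ they are $0,1,2$; in $\mathsf{letrec}\;\overline{x_i=M_i}\;\mathsf{in}\;N$, $N$ is $0$ and $M_i$ is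 $i$ for $1\le i\le m$. ''App'', ''seq'', ''letrec'' mean terms of the form $V\cdot M$, $M\;\mathsf{to}\;x\;\mathsf{in}\;N$, $\mathsf{letrec}\dots$. $\eta(p)$ (next redex): $\eta(1::p)$ if $P[p]$ is an app; $\eta(0::p)$ if $P[p]$ is a seq or a letrec; otherwise $p$. Conversely $\mathrm{root}(n::p)=\mathrm{root}(p)$ if ($n=1$ and $P[p]$ is an app) or ($n=0$ and $P[p]$ is a seq or letrec); otherwise $\mathrm{root}(q)=q$. *Argument frames.* $\mathrm{aframes}(p)$ is a list of items $\mathtt{ARG}\,q$, $\mathtt{SEQ}\,q$: $\mathrm{aframes}(\cdot)=\cdot$, and $\mathrm{aframes}(n::p)$ is: $\mathtt{ARG}\,p::\mathrm{aframes}(p)$ if $n=1$ and $P[p]$ is an app; if $n=0$ and $P[p]$ is a $\lambda$: $\mathrm{aframes}(p)$ with its first item removed if that item is an $\mathtt{ARG}$, and $\mathrm{aframes}(p)$ otherwise; $\mathtt{SEQ}\,p::\mathrm{aframes}(p)$ if $n=0$ and $P[p]$ is a seq; $\mathrm{aframes}(p)$ if ($n=0$ and $P[p]$ is a letrec) or ($n=1$ and $P[p]$ is a seq) or ($n\in\{1,2\}$ and $P[p]$ is an if0); and $\cdot$ otherwise. **CFG machine.** States $\langle p,e,k\rangle$: $p$ a path, $e$ an environment (finite partial map from paths to machine values), $k$ a list of frames. Machine values $v::=x\mid n\mid[p,e]$ (closure). Frames: $v\cdot\_$ and $[q,p,e]$ ($q,p$ paths). Operands $o::=\mathtt{VAR}\,x\mid\mathtt{NAT}\,n\mid\mathtt{LOC}\,p\mid\mathtt{LBL}\,p$.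 Evaluation: $\mathrm{eval}\,e\,(\mathtt{VAR}\,x)=x$, $\mathrm{eval}\,e\,(\mathtt{NAT}\,n)=n$, $\mathrm{eval}\,e\,(\mathtt{LOC}\,p)=e(p)$, $\mathrm{eval}\,e\,(\mathtt{LBL}\,p)=[p,e]$. For a list of operands, $\delta\,e\,(o_1,\dots,o_r)$ is the list of frames $(\mathrm{eval}\,e\,o_1)\cdot\_,\dots,(\mathrm{eval}\,e\,o_r)\cdot\_$. A CFG $G$ is a partial map from paths to pairs (instruction, list of next paths). $\mathrm{CFG.step}\,G$ is the partial function given by, according to $G(p)$ (undefined if no case applies): - $\mathtt{TAIL}\,o\,\bar o$, next $\cdot$: $\langle p,e,k\rangle\mapsto\langle p',e',\delta\,e\,\bar o\mathbin{+\!\!+}k\rangle$ if $\mathrm{eval}\,e\,o=[p',e']$. - $\mathtt{CALL}\,o\,\bar o\,q$, next $[p'']$: $\langle p,e,k\rangle\mapsto\langle p',e',\delta\,e\,\bar o\mathbin{+\!\!+}([q,p'',e]::k)\rangle$ if $\mathrm{eval}\,e\,o=[p',e']$. - $\mathtt{MOV}\,o\,q$, next $[p']$: $\langle p,e,k\rangle\mapsto\langle p',e[q\mapsto\mathrm{eval}\,e\,o],k\rangle$. - $\mathtt{RET}\,o$, next $\cdot$: $\langle p,e,[q,p',e']::k\rangle\mapsto\langle p',e'[q\mapsto\mathrm{eval}\,e\,o],k\rangle$. - $\mathtt{POP}\,q$, next $[p']$: $\langle p,e,(v\cdot\_)::k\rangle\mapsto\langle p',e[q\mapsto v],k\rangle$.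 - $\mathtt{IF0}\,o\,p_1\,p_2$, next $\cdot$: $\langle p,e,k\rangle\mapsto\langle p_1,e,k\rangle$ if $\mathrm{eval}\,e\,o=0$, and $\mapsto\langle p_2,e,k\rangle$ if $\mathrm{eval}\,e\,o$ is a nonzero number. - $\mathtt{OP}\,o_1\oplus o_2\;q$, next $[p']$: $\langle p,e,k\rangle\mapsto\langle p',e[q\mapsto n_1[\![\oplus]\!]n_2],k\rangle$ if $\mathrm{eval}\,e\,o_i=n_i$ are numbers. - $\mathtt{OPRET}\,o_1\oplus o_2$, next $\cdot$: $\langle p,e,[q,p',e']::k\rangle\mapsto\langle p',e'[q\mapsto n_1[\![\oplus]\!]n_2],k\rangle$ if $\mathrm{eval}\,e\,o_i=n_i$ are numbers. **compile.** For a path $p$ with $P[p]$ a value, the operand $\overline\gamma(p)$ is: $\mathtt{NAT}\,n$ if $P[p]=n$; $\mathtt{LBL}\,\eta(0::p)$ if $P[p]$ is a thunk; and if $P[p]=x$, it is obtained by walking up from $p$ to the innermost binder of $x$: $\mathtt{LOC}\,p_0$ if that binder is a $\lambda x$ or a ''$\mathsf{to}\;x\;\mathsf{in}$'' at $p_0$; $\mathtt{LBL}\,\eta(j::p_0)$ if it is a letrec at $p_0$ with $x=x_j$; $\mathtt{VAR}\,x$ if $x$ is free in $P$ at that occurrence. Write $\mathrm{args}(p)=(\bar o,r)$ where $\bar o$ lists $\overline\gamma(0::q)$ for the items $\mathtt{ARG}\,q$ of $\mathrm{aframes}(p)$ occurring before the first $\mathtt{SEQ}$ item (in order), and $r=\mathsf{some}\,q$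 if the first $\mathtt{SEQ}$ item is $\mathtt{SEQ}\,q$, $r=\mathsf{none}$ if there is none. $(\mathrm{compile}\,P)(p)$ is (undefined if no case applies): - $P[p]=\mathsf{force}\,V$: $\mathtt{TAIL}\,\overline\gamma(0::p)\,\bar o$, next $\cdot$, if $\mathrm{args}(p)=(\bar o,\mathsf{none})$; $\mathtt{CALL}\,\overline\gamma(0::p)\,\bar o\,q$, next $[\eta(1::q)]$, if $\mathrm{args}(p)=(\bar o,\mathsf{some}\,q)$. - $P[p]$ an if0: $\mathtt{IF0}\,\overline\gamma(0::p)\,\eta(1::p)\,\eta(2::p)$, next $\cdot$. - $P[p]=\mathsf{prd}\,V$: $\mathtt{MOV}\,\overline\gamma(0::p)\,q$, next $[\eta(1::q)]$, if $\mathrm{aframes}(p)=\mathtt{SEQ}\,q::a$; $\mathtt{RET}\,\overline\gamma(0::p)$, next $\cdot$, if $\mathrm{aframes}(p)=\cdot$. - $P[p]=\lambda x.M$: $\mathtt{MOV}\,\overline\gamma(0::p')\,p$, next $[\eta(0::p)]$, if $\mathrm{aframes}(p)=\mathtt{ARG}\,p'::a$; $\mathtt{POP}\,p$, next $[\eta(0::p)]$, if $\mathrm{aframes}(p)=\cdot$. - $P[p]=V_1\oplus V_2$: $\mathtt{OP}\,\overline\gamma(0::p)\oplus\overline\gamma(1::p)\;q$, next $[\eta(1::q)]$, if $\mathrm{aframes}(p)=\mathtt{SEQ}\,q::a$; $\mathtt{OPRET}\,\overline\gamma(0::p)\oplus\overline\gamma(1::p)$, next $\cdot$, if $\mathrm{aframes}(p)=\cdot$.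 **Well-formed states.** An environment $e$ covers a path $p$ if for every suffix $n::p_0$ of $p$ (including $p$ itself) with ($n=0$ and $P[p_0]$ a $\lambda$) or ($n=1$ and $P[p_0]$ a seq), $e(p_0)$ is defined. A state $\langle p,e,k\rangle$ is well-formed w.r.t. $P$ if: $P[p]$ is defined and is a term (computation) with $\eta(p)=p$, and $e$ covers $p$; every frame $[q,p',e']$ in $k$ has $P[q]$ a seq, $p'=\eta(1::q)$ and $e'$ covers $q$; and every closure $[q,e']$ occurring anywhere in the state (including inside environments and closures) has $e'$ covering $q$ and either $q=\eta(0::p_0)$ with $P[p_0]$ a thunk, or $q=\eta(j::p_0)$ with $P[p_0]$ a letrec and $j\ge1$ the index of one of its bindings. **unload.** (The composite of the unloadings CFG $\to$ PEK $\to$ PEAK $\to$ CEK $\to$ CBPV.) Define mutually recursively a substitution $\sigma(p,e)$ of CBPV values for variables, a term $T(p,e)$, and a CBPV value $U(v)$. $\sigma(\cdot,e)$ is the identity. $\sigma(n::p,e)$ is: $\sigma(p,e)$ updated with $x\mapsto U(e(p))$, if ($n=0$ and $P[p]=\lambda x.M$) or ($n=1$ and $P[p]=M\;\mathsf{to}\;x\;\mathsf{in}\;N$); if $P[p]=\mathsf{letrec}\;\overline{x_i=M_i}\;\mathsf{in}\;N$ (any $n$), $\sigma(p,e)$ updated with $x_j\mapsto\mathsf{thunk}\big((\mathsf{letrec}\;\overline{x_i=M_i}\;\mathsf{in}\;M_j)\,\sigma(p,e)\big)$ for all $j$; $\sigma(p,e)$ otherwise. $T(p,e)=(\mathsf{letrec}\;\overline{x_i=M_i}\;\mathsf{in}\;M_j)\,\sigma(p_0,e)$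 if $p=j::p_0$ with $j\ge1$ and $P[p_0]=\mathsf{letrec}\;\overline{x_i=M_i}\;\mathsf{in}\;N$; otherwise $T(p,e)=P[p]\,\sigma(p,e)$. $U(x)=x$, $U(n)=n$, $U([q,e])=\mathsf{thunk}\,T(\mathrm{root}(q),e)$. (Substitutions are applied simultaneously and capture-avoidingly.) Next define $\mathrm{plug}(M,e,a,k)$ for $a$ a list of argument frames: - $\mathrm{plug}(M,e,\cdot,\cdot)=M$; - $\mathrm{plug}(M,e,\mathtt{ARG}\,p::a,k)=\mathrm{plug}\big((P[0::p]\,\sigma(p,e))\cdot M,\;e,a,k\big)$; - $\mathrm{plug}(M,e,\mathtt{SEQ}\,p::a,k)=\mathrm{plug}\big(M\;\mathsf{to}\;x\;\mathsf{in}\;(N\sigma),\;e,a,k\big)$, where $P[p]=M_0\;\mathsf{to}\;x\;\mathsf{in}\;N$ and $\sigma$ is $\sigma(p,e)$ with $x$ left fixed (capture-avoiding); - $\mathrm{plug}(M,e,\cdot,(v\cdot\_)::k)=\mathrm{plug}(U(v)\cdot M,\;e,\cdot,k)$; - $\mathrm{plug}(M,e,\cdot,[p,q,e']::k)=\mathrm{plug}\big(M,\;e',\;\mathtt{SEQ}\,p::\mathrm{aframes}(p),\;k\big)$. Finally $\mathrm{unload}\,P\,\langle p,e,k\rangle=\mathrm{plug}\big(T(\mathrm{root}(p),e),\,e,\,\mathrm{aframes}(\mathrm{root}(p)),\,k\big)$. *)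

(* Defs.v *)
From Stdlib Require Import List Arith ClassicalEpsilon.
Import ListNotations.

Set Implicit Arguments.
Unset Strict Implicit.
Unset Printing Implicit Defensive.

(* Terms are taken up to renaming of bound variables, in de Bruijn notation:
   in [Lam M] and in the second component of [Seq M N] (M to x in N) index 0
   is the bound variable; [Letrec [M_1; ...; M_m] N] binds m variables in N and
   in every M_i, index j - 1 being x_j.  Indices that point beyond all enclosing
   binders are the free variables; terms may be open. *)

Section Defs.

(* The arithmetic operators and their interpretation. *)
Variables (Op : Type) (interp : Op -> nat -> nat -> nat).

Inductive value : Type :=
| Var (x : nat)
| Nat (n : nat)
| Thunk (M : term)
with term : Type :=
| Force (V : value)
| Letrec (Ms : list term) (N : term)
| Prd (V : value)
| Seq (M N : term)
| App (V : value) (M : term)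
| Lam (M : term)
| Arith (o : Op) (V1 V2 : value)
| If0 (V : value) (M1 M2 : term).

(** * Simultaneous capture-avoiding substitution *)

Definition upren (r : nat -> nat) (i : nat) : nat :=
  match i with 0 => 0 | S j => S (r j) end.

Fixpoint ren_value (r : nat -> nat) (V : value) : value :=
  match V with
  | Var x => Var (r x)
  | Nat n => Nat n
  | Thunk M => Thunk (ren_term r M)
  end
with ren_term (r : nat -> nat) (M : term) : term :=
  match M with
  | Force V => Force (ren_value r V)
  | Letrec Ms N =>
      let r' := Nat.iter (length Ms) upren r in
      Letrec (map (ren_term r') Ms) (ren_term r' N)
  | Prd V => Prd (ren_value r V)
  | Seq M N => Seq (ren_term r M) (ren_term (upren r) N)
  | App V M => App (ren_value r V) (ren_term r M)
  | Lam M => Lam (ren_term (upren r) M)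
  | Arith o V1 V2 => Arith o (ren_value r V1) (ren_value r V2)
  | If0 V M1 M2 => If0 (ren_value r V) (ren_term r M1) (ren_term r M2)
  end.

Definition substitution : Type := nat -> value.

(* Passing under one binder: the bound variable is left fixed. *)
Definition up (s : substitution) : substitution :=
  fun i => match i with 0 => Var 0 | S j => ren_value S (s j) end.

Fixpoint subst_value (s : substitution) (V : value) : value :=
  match V with
  | Var x => s x
  | Nat n => Nat n
  | Thunk M => Thunk (subst s M)
  end
with subst (s : substitution) (M : term) : term :=
  match M with
  | Force V => Force (subst_value s V)
  | Letrec Ms N =>
      let s' := Nat.iter (length Ms) up s in
      Letrec (map (subst s') Ms) (subst s' N)
  | Prd V => Prd (subst_value s V)
  | Seq M N => Seq (subst s M) (subst (up s) N)
  | App V M => App (subst_value s V) (subst s M)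
  | Lam M => Lam (subst (up s) M)
  | Arith o V1 V2 => Arith o (subst_value s V1) (subst_value s V2)
  | If0 V M1 M2 => If0 (subst_value s V) (subst s M1) (subst s M2)
  end.

(* [extend [V_1; ...; V_m] s] is [s] updated by sending the m innermost bound
   variables to V_1, ..., V_m. *)
Definition extend (Vs : list value) (s : substitution) : substitution :=
  fun i => match nth_error Vs i with
           | Some V => V
           | None => s (i - length Vs)
           end.

(* {V_1/x_1, ..., V_m/x_m} N *)
Definition inst (Vs : list value) (N : term) : term := subst (extend Vs Var) N.

(** * The CBPV semantics *)

Inductive unroll : term -> term -> Prop :=
| unroll_refl M : unroll M M
| unroll_letrec Ms N N' :
    unroll (inst (map (fun M => Thunk (Letrec Ms M)) Ms) N) N' ->
    unroll (Letrec Ms N) N'.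

Inductive red : term -> term -> Prop :=
| red_force M : red (Force (Thunk M)) M
| red_prd M V N : unroll M (Prd V) -> red (Seq M N) (inst [V] N)
| red_beta V M N : unroll M (Lam N) -> red (App V M) (inst [V] N)
| red_seq M M' N : red M M' -> red (Seq M N) (Seq M' N)
| red_app V M M' : red M M' -> red (App V M) (App V M')
| red_unroll N N' M : unroll N N' -> red N' M -> red N M
| red_arith M o n1 n2 N :
    unroll M (Arith o (Nat n1) (Nat n2)) ->
    red (Seq M N) (inst [Nat (interp o n1 n2)] N)
| red_if0_zero M1 M2 : red (If0 (Nat 0) M1 M2) M1
| red_if0_nonzero n M1 M2 : n <> 0 -> red (If0 (Nat n) M1 M2) M2.

(* The relation [red] as a partial function; [cbpv_stepP] below justifies it. *)
Definition cbpv_step (M : term) : option term :=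
  match excluded_middle_informative (exists N, red M N) with
  | left h => Some (proj1_sig (constructive_indefinite_description _ h))
  | right _ => None
  end.

Definition is_letrec (M : term) : bool :=
  match M with Letrec _ _ => true | _ => false end.

Lemma unroll_head M N : unroll M N -> is_letrec M = false -> N = M.
Proof. intros H; destruct H; simpl; congruence. Qed.

Lemma unroll_fun M A B :
  unroll M A -> is_letrec A = false -> unroll M B -> is_letrec B = false ->
  A = B.
Proof.
intros HA; revert B; induction HA as [M|Ms N A HA IH]; intros B hA HB hB.
- symmetry; now apply unroll_head.
- inversion HB; subst; simpl in *; [discriminate | now apply IH].
Qed.

Lemma red_inv M R : red M R ->
  match M with
  | Force V => V = Thunk R
  | Letrec Ms N => red (inst (map (fun M => Thunk (Letrec Ms M)) Ms) N) R
  | Prd _ | Lam _ | Arith _ _ _ => False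
  | Seq M N =>
      (exists V, unroll M (Prd V) /\ R = inst [V] N) \/
      (exists M', red M M' /\ R = Seq M' N) \/
      (exists o n1 n2, unroll M (Arith o (Nat n1) (Nat n2)) /\
                       R = inst [Nat (interp o n1 n2)] N)
  | App V M =>
      (exists N, unroll M (Lam N) /\ R = inst [V] N) \/
      (exists M', red M M' /\ R = App V M')
  | If0 V M1 M2 =>
      (V = Nat 0 /\ R = M1) \/ (exists n, V = Nat (S n) /\ R = M2)
  end.
Proof.
intros H; induction H as
  [M|M V N HM|V M N HM|M M' N HM _|V M M' HM _|N N' M HN HM IH
  |M o n1 n2 N HM|M1 M2|[|n] M1 M2 hn]; try (now eauto 8).
destruct HN as [N|Ms N N' HN]; [exact IH | exact (red_unroll HN HM)].
Qed.

Lemma red_unroll_inv M N R : unroll M N -> red M R -> red N R.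
Proof.
intros H; induction H as [|Ms N N' H IH]; intros HR; [exact HR|].
exact (IH (red_inv HR)).
Qed.

Lemma red_deterministic M R1 R2 : red M R1 -> red M R2 -> R1 = R2.
Proof.
intros H1; revert R2; induction H1 as
  [M|M V N HM|V M N HM|M M' N HM IH|V M M' HM IH|N N' M HN HM IH
  |M o n1 n2 N HM|M1 M2|n M1 M2 hn]; intros R2 H2.
- apply red_inv in H2; congruence.
- destruct (red_inv H2)
    as [[W [HW ->]]|[[M' [HM' _]]|[o [n1 [n2 [HA _]]]]]].
  + now injection (unroll_fun HM eq_refl HW eq_refl) as ->.
  + destruct (red_inv (red_unroll_inv HM HM')).
  + discriminate (unroll_fun HM eq_refl HA eq_refl).
- destruct (red_inv H2) as [[N' [HN ->]]|[M' [HM' _]]].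
  + now injection (unroll_fun HM eq_refl HN eq_refl) as ->.
  + destruct (red_inv (red_unroll_inv HM HM')).
- destruct (red_inv H2)
    as [[W [HW _]]|[[M'' [HM' ->]]|[o [n1 [n2 [HA _]]]]]].
  + destruct (red_inv (red_unroll_inv HW HM)).
  + now rewrite (IH _ HM').
  + destruct (red_inv (red_unroll_inv HA HM)).
- destruct (red_inv H2) as [[N' [HN _]]|[M'' [HM' ->]]].
  + destruct (red_inv (red_unroll_inv HN HM)).
  + now rewrite (IH _ HM').
- exact (IH _ (red_unroll_inv HN H2)).
- destruct (red_inv H2)
    as [[W [HW _]]|[[M' [HM' _]]|[o' [m1 [m2 [HA ->]]]]]].
  + discriminate (unroll_fun HM eq_refl HW eq_refl).
  + destruct (red_inv (red_unroll_inv HM HM')).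
  + now injection (unroll_fun HM eq_refl HA eq_refl) as -> -> ->.
- destruct (red_inv H2) as [[_ ->]|[n [E _]]]; [easy | discriminate E].
- destruct (red_inv H2) as [[E ->]|[m [_ ->]]]; congruence.
Qed.

Lemma cbpv_stepP M N : cbpv_step M = Some N <-> red M N.
Proof.
unfold cbpv_step; destruct excluded_middle_informative as [h|h].
- destruct constructive_indefinite_description as [N' HN']; simpl; split.
  + now intros [= <-].
  + intros HN; f_equal; exact (red_deterministic HN' HN).
- split; [discriminate | intros HN; destruct h; now exists N].
Qed.

(** * Paths *)

Definition path : Type := list nat.

Inductive phrase : Type :=
| PVal (V : value)
| PTm (M : term).

Definition child (n : nat) (t : phrase) : option phrase :=
  match t, n with
  | PVal (Thunk M), 0 => Some (PTm M)
  | PTm (Force V), 0 => Some (PVal V)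
  | PTm (Letrec _ N), 0 => Some (PTm N)
  | PTm (Letrec Ms _), S j => option_map PTm (nth_error Ms j)
  | PTm (Prd V), 0 => Some (PVal V)
  | PTm (Seq M _), 0 => Some (PTm M)
  | PTm (Seq _ N), 1 => Some (PTm N)
  | PTm (App V _), 0 => Some (PVal V)
  | PTm (App _ M), 1 => Some (PTm M)
  | PTm (Lam M), 0 => Some (PTm M)
  | PTm (Arith _ V1 _), 0 => Some (PVal V1)
  | PTm (Arith _ _ V2), 1 => Some (PVal V2)
  | PTm (If0 V _ _), 0 => Some (PVal V)
  | PTm (If0 _ M1 _), 1 => Some (PTm M1)
  | PTm (If0 _ _ M2), 2 => Some (PTm M2)
  | _, _ => None
  end.

(* [subterm P p] is P[p]. *)
Fixpoint subterm (P : term) (p : path) : option phrase :=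
  match p with
  | [] => Some (PTm P)
  | n :: p => match subterm P p with
              | Some t => child n t
              | None => None
              end
  end.

(* [descend M p] is eta(p) for a path p with P[p] = M. *)
Fixpoint descend (M : term) (p : path) : path :=
  match M with
  | App _ M => descend M (1 :: p)
  | Seq M _ => descend M (0 :: p)
  | Letrec _ N => descend N (0 :: p)
  | _ => p
  end.

Definition eta (P : term) (p : path) : path :=
  match subterm P p with
  | Some (PTm M) => descend M p
  | _ => p
  end.

Fixpoint root (P : term) (p : path) : path :=
  match p with
  | [] => []
  | n :: p' =>
      match n, subterm P p' with
      | 1, Some (PTm (App _ _)) => root P p'
      | 0, Some (PTm (Seq _ _)) => root P p'
      | 0, Some (PTm (Letrec _ _)) => root P p'
      | _, _ => p
      end
  end.

Inductive aframe : Type :=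
| ARG (q : path)
| SEQ (q : path).

Fixpoint aframes (P : term) (p : path) : list aframe :=
  match p with
  | [] => []
  | n :: p =>
      match n, subterm P p with
      | 1, Some (PTm (App _ _)) => ARG p :: aframes P p
      | 0, Some (PTm (Lam _)) =>
          match aframes P p with
          | ARG _ :: a => a
          | a => a
          end
      | 0, Some (PTm (Seq _ _)) => SEQ p :: aframes P p
      | 0, Some (PTm (Letrec _ _)) => aframes P p
      | 1, Some (PTm (Seq _ _)) => aframes P p
      | (1 | 2), Some (PTm (If0 _ _ _)) => aframes P p
      | _, _ => []
      end
  end.

(** * The CFG machine *)

(* Finite partial maps from paths, as association lists (first match wins). *)
Definition lookup (A : Type) (e : list (path * A)) (p : path) : option A :=
  option_map snd
    (find (fun b => if list_eq_dec Nat.eq_dec (fst b) p then true else false) e).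

(* [MVar x] is the free variable x of the whole program. *)
Inductive mvalue : Type :=
| MVar (x : nat)
| MNat (n : nat)
| MClos (p : path) (e : list (path * mvalue)).

Definition env : Type := list (path * mvalue).

Definition update (e : env) (p : path) (v : mvalue) : env := (p, v) :: e.

Inductive frame : Type :=
| FArg (v : mvalue)
| FRet (q p : path) (e : env).

Record state : Type := State { st_path : path; st_env : env; st_stack : list frame }.

Inductive operand : Type :=
| VAR (x : nat)
| NAT (n : nat)
| LOC (p : path)
| LBL (p : path).

Inductive instr : Type :=
| TAIL (o : operand) (os : list operand)
| CALL (o : operand) (os : list operand) (q : path)
| MOV (o : operand) (q : path)
| RET (o : operand)
| POP (q : path)
| IF0 (o : operand) (p1 p2 : path)
| OP (o1 : operand) (op : Op) (o2 : operand) (q : path)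
| OPRET (o1 : operand) (op : Op) (o2 : operand).

Definition cfg : Type := path -> option (instr * list path).

Definition eval (e : env) (o : operand) : option mvalue :=
  match o with
  | VAR x => Some (MVar x)
  | NAT n => Some (MNat n)
  | LOC p => lookup e p
  | LBL p => Some (MClos p e)
  end.

Fixpoint delta (e : env) (os : list operand) : option (list frame) :=
  match os with
  | [] => Some []
  | o :: os => match eval e o, delta e os with
               | Some v, Some d => Some (FArg v :: d)
               | _, _ => None
               end
  end.

Definition cfg_step (G : cfg) (s : state) : option state :=
  let 'State p e k := s in
  match G p with
  | Some (TAIL o os, []) =>
      match eval e o, delta e os with
      | Some (MClos p' e'), Some d => Some (State p' e' (d ++ k))
      | _, _ => None
      end
  | Some (CALL o os q, [p'']) =>
      match eval e o, delta e os with
      | Some (MClos p' e'), Some d => Some (State p' e' (d ++ FRet q p'' e :: k))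
      | _, _ => None
      end
  | Some (MOV o q, [p']) =>
      match eval e o with
      | Some v => Some (State p' (update e q v) k)
      | None => None
      end
  | Some (RET o, []) =>
      match eval e o, k with
      | Some v, FRet q p' e' :: k' => Some (State p' (update e' q v) k')
      | _, _ => None
      end
  | Some (POP q, [p']) =>
      match k with
      | FArg v :: k' => Some (State p' (update e q v) k')
      | _ => None
      end
  | Some (IF0 o p1 p2, []) =>
      match eval e o with
      | Some (MNat 0) => Some (State p1 e k)
      | Some (MNat (S _)) => Some (State p2 e k)
      | _ => None
      end
  | Some (OP o1 op o2 q, [p']) =>
      match eval e o1, eval e o2 with
      | Some (MNat n1), Some (MNat n2) =>
          Some (State p' (update e q (MNat (interp op n1 n2))) k)
      | _, _ => None
      end
  | Some (OPRET o1 op o2, []) =>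
      match eval e o1, eval e o2, k with
      | Some (MNat n1), Some (MNat n2), FRet q p' e' :: k' =>
          Some (State p' (update e' q (MNat (interp op n1 n2))) k')
      | _, _, _ => None
      end
  | _ => None
  end.

(** * Compilation *)

(* The operand for an occurrence at path p of the variable with index x:
   walk up to its binder, discarding the binders passed on the way. *)
Fixpoint resolve (P : term) (p : path) (x : nat) : operand :=
  match p with
  | [] => VAR x
  | n :: p =>
      match n, subterm P p with
      | 0, Some (PTm (Lam _)) | 1, Some (PTm (Seq _ _)) =>
          match x with
          | 0 => LOC p
          | S y => resolve P p y
          end
      | _, Some (PTm (Letrec Ms _)) =>
          if x <? length Ms then LBL (eta P (S x :: p))
          else resolve P p (x - length Ms)
      | _, _ => resolve P p x
      end
  end.

(* The last case, where P[p] is not a value, is not used. *)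
Definition gamma (P : term) (p : path) : operand :=
  match subterm P p with
  | Some (PVal (Nat n)) => NAT n
  | Some (PVal (Thunk _)) => LBL (eta P (0 :: p))
  | Some (PVal (Var x)) => resolve P p x
  | _ => NAT 0
  end.

Fixpoint args_of (P : term) (a : list aframe) : list operand * option path :=
  match a with
  | [] => ([], None)
  | SEQ q :: _ => ([], Some q)
  | ARG q :: a => let (os, r) := args_of P a in (gamma P (0 :: q) :: os, r)
  end.

Definition args (P : term) (p : path) : list operand * option path :=
  args_of P (aframes P p).

Definition compile (P : term) : cfg := fun p =>
  match subterm P p with
  | Some (PTm (Force _)) =>
      match args P p with
      | (os, None) => Some (TAIL (gamma P (0 :: p)) os, [])
      | (os, Some q) => Some (CALL (gamma P (0 :: p)) os q, [eta P (1 :: q)])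
      end
  | Some (PTm (If0 _ _ _)) =>
      Some (IF0 (gamma P (0 :: p)) (eta P (1 :: p)) (eta P (2 :: p)), [])
  | Some (PTm (Prd _)) =>
      match aframes P p with
      | SEQ q :: _ => Some (MOV (gamma P (0 :: p)) q, [eta P (1 :: q)])
      | [] => Some (RET (gamma P (0 :: p)), [])
      | _ => None
      end
  | Some (PTm (Lam _)) =>
      match aframes P p with
      | ARG p' :: _ => Some (MOV (gamma P (0 :: p')) p, [eta P (0 :: p)])
      | [] => Some (POP p, [eta P (0 :: p)])
      | _ => None
      end
  | Some (PTm (Arith op _ _)) =>
      match aframes P p with
      | SEQ q :: _ =>
          Some (OP (gamma P (0 :: p)) op (gamma P (1 :: p)) q, [eta P (1 :: q)])
      | [] => Some (OPRET (gamma P (0 :: p)) op (gamma P (1 :: p)), [])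
      | _ => None
      end
  | _ => None
  end.

(** * Well-formed states *)

(* [l ++ n :: p0 = p] says that [n :: p0] is a nonempty suffix of [p]. *)
Definition covers (P : term) (e : env) (p : path) : Prop :=
  forall l n p0, l ++ n :: p0 = p ->
    (n = 0 /\ exists M, subterm P p0 = Some (PTm (Lam M))) \/
    (n = 1 /\ exists M N, subterm P p0 = Some (PTm (Seq M N))) ->
    exists v, lookup e p0 = Some v.

Definition entry (P : term) (q : path) : Prop :=
  (exists p0 M, subterm P p0 = Some (PVal (Thunk M)) /\ q = eta P (0 :: p0)) \/
  (exists j p0 Ms N, subterm P p0 = Some (PTm (Letrec Ms N)) /\
     1 <= j <= length Ms /\ q = eta P (j :: p0)).

Inductive wf_value (P : term) : mvalue -> Prop :=
| wf_MVar x : wf_value P (MVar x)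
| wf_MNat n : wf_value P (MNat n)
| wf_MClos q e :
    covers P e q -> entry P q ->
    (forall p v, lookup e p = Some v -> wf_value P v) ->
    wf_value P (MClos q e).

Definition wf_env (P : term) (e : env) : Prop :=
  forall p v, lookup e p = Some v -> wf_value P v.

Definition wf_frame (P : term) (f : frame) : Prop :=
  match f with
  | FArg v => wf_value P v
  | FRet q p' e' =>
      (exists M N, subterm P q = Some (PTm (Seq M N))) /\
      p' = eta P (1 :: q) /\ covers P e' q /\ wf_env P e'
  end.

Definition wf_state (P : term) (s : state) : Prop :=
  let 'State p e k := s in
  (exists M, subterm P p = Some (PTm M)) /\ eta P p = p /\
  covers P e p /\ wf_env P e /\ Forall (wf_frame P) k.

(** * Unloading *)

(* Here [d] stands for an environment e whose machine values have already been
   unloaded: d(p) = U(e(p)).  This makes the mutual recursion between sigma, T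
   and U structural.  Unloading is a total function: the values taken at
   undefined entries of [d], or where P[p] does not have the expected shape, are
   arbitrary and do not arise from well-formed states. *)
Fixpoint sigma (P : term) (p : path) (d : list (path * value)) : substitution :=
  match p with
  | [] => Var
  | n :: p =>
      match n, subterm P p with
      | 0, Some (PTm (Lam _)) | 1, Some (PTm (Seq _ _)) =>
          let V := match lookup d p with Some V => V | None => Nat 0 end in
          extend [V] (sigma P p d)
      | _, Some (PTm (Letrec Ms _)) =>
          let s := sigma P p d in
          extend (map (fun M => Thunk (subst s (Letrec Ms M))) Ms) s
      | _, _ => sigma P p d
      end
  end.

Definition unload_at (P : term) (p : path) (d : list (path * value)) : term :=
  match subterm P p with
  | Some (PTm M) => subst (sigma P p d) M
  | _ => Prd (Nat 0)
  end.

Definition unload_path (P : term) (p : path) (d : list (path * value)) : term :=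
  match p with
  | S j :: p0 =>
      match subterm P p0 with
      | Some (PTm (Letrec Ms _)) =>
          match nth_error Ms j with
          | Some M => subst (sigma P p0 d) (Letrec Ms M)
          | None => unload_at P p d
          end
      | _ => unload_at P p d
      end
  | _ => unload_at P p d
  end.

Fixpoint unload_value (P : term) (v : mvalue) : value :=
  match v with
  | MVar x => Var x
  | MNat n => Nat n
  | MClos q e =>
      Thunk (unload_path P (root P q)
               (map (fun b : path * mvalue =>
                       let (p, w) := b in (p, unload_value P w)) e))
  end.

Definition unload_env (P : term) (e : env) : list (path * value) :=
  map (fun b : path * mvalue => let (p, w) := b in (p, unload_value P w)) e.

Fixpoint plug_args (P : term) (M : term) (e : env) (a : list aframe) : term :=
  match a with
  | [] => M
  | ARG p :: a =>
      let V := match subterm P (0 :: p) with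
               | Some (PVal V) => subst_value (sigma P p (unload_env P e)) V
               | _ => Nat 0
               end in
      plug_args P (App V M) e a
  | SEQ p :: a =>
      let N := match subterm P p with
               | Some (PTm (Seq _ N)) => subst (up (sigma P p (unload_env P e))) N
               | _ => Prd (Nat 0)
               end in
      plug_args P (Seq M N) e a
  end.

Fixpoint plug (P : term) (M : term) (e : env) (a : list aframe) (k : list frame)
  : term :=
  let M' := plug_args P M e a in
  match k with
  | [] => M'
  | FArg v :: k => plug P (App (unload_value P v) M') e [] k
  | FRet p _ e' :: k => plug P M' e' (SEQ p :: aframes P p) k
  end.

Definition unload (P : term) (s : state) : term :=
  let 'State p e k := s in
  plug P (unload_path P (root P p) (unload_env P e)) e (aframes P (root P p)) k.

End Defs.

(* Main.v *)
(* Unloading a state at p fills an evaluation context, read off the argument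
   frames of root(p) and the stack, with the term at root(p).  Moving from
   root(p) down to p turns each app and seq passed on the way into a frame and
   unrolls each letrec.  Unrolling under a frame is not a [red] or [unroll] step,
   but it changes neither the reducts of a term nor the answers (prd, lambda or
   arithmetic terms) it unrolls to, and this equivalence is preserved by
   evaluation contexts.  So the unloaded state may be taken to be P[p] sigma(p,e)
   in the context of the frames of p.  As p = eta(p), P[p] is a force, an if0 or
   an answer, which reduces alone or with the innermost frame; operands unload to
   the values they compile, so each such step is the machine's.  An environment
   update at p does not disturb the frames of p, since they only look up proper
   suffixes of p. *)

From Stdlib Require Import List Arith Lia FunctionalExtensionality.
Require Import Defs.
Import ListNotations.

Set Implicit Arguments.
Unset Strict Implicit.

Arguments Var {Op} x.
Arguments Nat {Op} n.

(** * Substitution *)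

Section Substitution.

Variable Op : Type.
Implicit Types (V : value Op) (M N : term Op) (s t : substitution Op).

Section Induction.

Variables (PV : value Op -> Prop) (PT : term Op -> Prop).
Hypothesis HVar : forall x, PV (Var x).
Hypothesis HNat : forall n, PV (Nat n).
Hypothesis HThunk : forall M, PT M -> PV (Thunk M).
Hypothesis HForce : forall V, PV V -> PT (Force V).
Hypothesis HLetrec : forall Ms N, Forall PT Ms -> PT N -> PT (Letrec Ms N).
Hypothesis HPrd : forall V, PV V -> PT (Prd V).
Hypothesis HSeq : forall M N, PT M -> PT N -> PT (Seq M N).
Hypothesis HApp : forall V M, PV V -> PT M -> PT (App V M).
Hypothesis HLam : forall M, PT M -> PT (Lam M).
Hypothesis HArith : forall o V1 V2, PV V1 -> PV V2 -> PT (Arith o V1 V2).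
Hypothesis HIf0 : forall V M1 M2, PV V -> PT M1 -> PT M2 -> PT (If0 V M1 M2).

(** The bindings of a [Letrec] form a list nested in the type of terms; the inner [fix] supplies the
    [Forall] hypothesis for them. *)
Fixpoint value_nested_ind V : PV V :=
  match V with
  | Var x => HVar x
  | Nat n => HNat n
  | Thunk M => HThunk (term_nested_ind M)
  end
with term_nested_ind M : PT M :=
  match M with
  | Force V => HForce (value_nested_ind V)
  | Letrec Ms N =>
      HLetrec
        ((fix all Ms : Forall PT Ms :=
            match Ms with
            | [] => Forall_nil _
            | M :: Ms => Forall_cons _ (term_nested_ind M) (all Ms)
            end) Ms)
        (term_nested_ind N)
  | Prd V => HPrd (value_nested_ind V)
  | Seq M N => HSeq (term_nested_ind M) (term_nested_ind N)
  | App V M => HApp (value_nested_ind V) (term_nested_ind M)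
  | Lam M => HLam (term_nested_ind M)
  | Arith o V1 V2 => HArith o (value_nested_ind V1) (value_nested_ind V2)
  | If0 V M1 M2 =>
      HIf0 (value_nested_ind V) (term_nested_ind M1) (term_nested_ind M2)
  end.

Lemma syntax_ind : (forall V, PV V) /\ (forall M, PT M).
Proof. split; [exact value_nested_ind | exact term_nested_ind]. Qed.

End Induction.

(** A [Letrec] passes under [length Ms] binders at once; this lifts a law for one binder to that
    case. *)
Lemma iter_comp (A B C : Type) (f : A -> A) (g : B -> B) (h : C -> C)
  (op : A -> B -> C) :
  (forall a b, h (op a b) = op (f a) (g b)) ->
  forall m a b, Nat.iter m h (op a b) = op (Nat.iter m f a) (Nat.iter m g b).
Proof. intros H m a b; induction m as [|m IH]; simpl; congruence. Qed.

(* [up_comp] says that the composition [op] of renamings or substitutions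
   commutes with passing under one binder. *)
Ltac fuse op up_comp :=
  let H := fresh in
  pose proof (iter_comp (op := op) up_comp) as H; cbn beta in H;
  apply syntax_ind; simpl; intros; f_equal; rewrite ?map_map, ?length_map;
  try (apply map_ext_Forall; eapply Forall_impl; [|eassumption]; simpl; intros);
  try match goal with IH : context [?N] |- _ _ (_ _ ?N) = _ => rewrite IH end;
  solve [easy | now rewrite <- up_comp | now rewrite <- H].

(** The four composition laws come in dependency order: under a binder, [ren_subst] relies on
    [ren_ren], and [subst_subst] on [subst_ren] and [ren_subst]. *)
Lemma ren_ren :
  (forall V r r', ren_value r (ren_value r' V) = ren_value (fun x => r (r' x)) V) /\
  (forall M r r', ren_term r (ren_term r' M) = ren_term (fun x => r (r' x)) M).
Proof.
assert (U : forall r r' : nat -> nat,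
  upren (fun x => r (r' x)) = (fun x => upren r (upren r' x))).
{ intros r r'; extensionality x; now destruct x. }
fuse (fun (r r' : nat -> nat) x => r (r' x)) U.
Qed.

Lemma subst_ren :
  (forall V s r, subst_value s (ren_value r V) = subst_value (fun x => s (r x)) V) /\
  (forall M s r, subst s (ren_term r M) = subst (fun x => s (r x)) M).
Proof.
assert (U : forall s (r : nat -> nat),
  up (fun x => s (r x)) = (fun x => up s (upren r x))).
{ intros s r; extensionality x; now destruct x. }
fuse (fun (s : substitution Op) (r : nat -> nat) x => s (r x)) U.
Qed.

Lemma ren_subst :
  (forall V r s, ren_value r (subst_value s V) =
                 subst_value (fun x => ren_value r (s x)) V) /\
  (forall M r s, ren_term r (subst s M) =
                 subst (fun x => ren_value r (s x)) M).
Proof.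
assert (U : forall r s,
  up (fun x => ren_value r (s x)) = (fun x => ren_value (upren r) (up s x))).
{ intros r s; extensionality x; destruct x as [|x]; [easy|]; simpl.
  now rewrite !(proj1 ren_ren). }
fuse (fun r (s : substitution Op) x => ren_value r (s x)) U.
Qed.

Lemma subst_subst :
  (forall V t s, subst_value t (subst_value s V) =
                 subst_value (fun x => subst_value t (s x)) V) /\
  (forall M t s, subst t (subst s M) = subst (fun x => subst_value t (s x)) M).
Proof.
assert (U : forall t s,
  up (fun x => subst_value t (s x)) = (fun x => subst_value (up t) (up s x))).
{ intros t s; extensionality x; destruct x as [|x]; [easy|]; simpl.
  now rewrite (proj1 subst_ren), (proj1 ren_subst). }
fuse (fun (t s : substitution Op) x => subst_value t (s x)) U.
Qed.

Lemma subst_id :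
  (forall V, subst_value Var V = V) /\ (forall M, subst Var M = M).
Proof.
assert (U : up (@Var Op) = Var).
{ extensionality x; now destruct x. }
assert (Us : forall m, Nat.iter m (@up Op) Var = Var).
{ induction m as [|m IH]; simpl; congruence. }
apply syntax_ind; simpl; intros; rewrite ?Us, ?U; f_equal; auto.
rewrite <- (map_id Ms) at 2; apply map_ext_Forall; assumption.
Qed.

Lemma iter_up m s x :
  Nat.iter m (@up Op) s x =
  if x <? m then Var x else ren_value (Nat.add m) (s (x - m)).
Proof.
revert x; induction m as [|m IH]; intros x; simpl.
- rewrite Nat.sub_0_r; symmetry.
  (* Renaming by [Nat.add 0] is the identity since, read as a substitution, it is [Var]. *)
  rewrite <- (proj1 subst_id (ren_value _ _)), (proj1 subst_ren).
  apply subst_id.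
- destruct x as [|x]; [easy|]; simpl; rewrite IH.
  change (S x <? S m) with (x <? m); destruct (x <? m); [easy|].
  apply ren_ren.
Qed.

(** Links the semantics, which instantiates by [inst], to [sigma], which is built by [extend]. The
    shift that [up] puts on the outer variables is undone by [inst]. *)
Lemma inst_subst (Vs : list (value Op)) s N :
  inst Vs (subst (Nat.iter (length Vs) (@up Op) s) N) = subst (extend Vs s) N.
Proof.
unfold inst; rewrite (proj2 subst_subst); f_equal; extensionality x.
rewrite iter_up; destruct (Nat.ltb_spec x (length Vs)) as [H|H]; simpl.
- unfold extend; destruct (nth_error Vs x) eqn:E; [easy|].
  apply nth_error_None in E; lia.
- rewrite (proj1 subst_ren); unfold extend at 2.
  rewrite (proj2 (nth_error_None Vs x) H).
  etransitivity; [|apply subst_id]; f_equal; extensionality y.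
  unfold extend; simpl; rewrite (proj2 (nth_error_None Vs _)) by lia.
  f_equal; lia.
Qed.

Lemma inst_subst1 V s N : inst [V] (subst (up s) N) = subst (extend [V] s) N.
Proof. exact (inst_subst [V] s N). Qed.

Lemma extend_cons_S V s x : extend [V] s (S x) = s x.
Proof. unfold extend; simpl; rewrite Nat.sub_0_r; now destruct x. Qed.

End Substitution.
(** * Evaluation contexts *)

Section Semantics.

Variables (Op : Type) (interp : Op -> nat -> nat -> nat).
Implicit Types (V : value Op) (M N R A : term Op).

Notation red := (red interp).
Notation step := (cbpv_step interp).

Inductive eframe : Type :=
| EApp (V : value Op)
| ESeq (N : term Op).

Definition wrap (F : eframe) M : term Op :=
  match F with EApp V => App V M | ESeq N => Seq M N end.

(** The innermost frame comes first, as in [aframes] and on the machine's stack. *)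
Fixpoint fill (C : list eframe) M : term Op :=
  match C with
  | [] => M
  | F :: C => fill C (wrap F M)
  end.

Lemma fill_app C1 C2 M : fill (C1 ++ C2) M = fill C2 (fill C1 M).
Proof. revert M; induction C1 as [|F C1 IH]; intros M; [easy | apply IH]. Qed.

Definition answer M : bool :=
  match M with Prd _ | Lam _ | Arith _ _ _ => true | _ => false end.

(* Closed under evaluation contexts, unlike [unroll]; the second component is
   what a context can observe of a term that does not reduce. *)
Definition equi M M' : Prop :=
  (forall R, red M R <-> red M' R) /\
  (forall A, answer A = true -> unroll M A <-> unroll M' A).

Lemma equi_refl M : equi M M.
Proof. split; tauto. Qed.

Lemma equi_trans M1 M2 M3 : equi M1 M2 -> equi M2 M3 -> equi M1 M3.
Proof.
intros [H1 H1'] [H2 H2']; split; [intros R | intros A hA].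
- now rewrite H1.
- now rewrite H1' by exact hA; apply H2'.
Qed.

Lemma equi_unroll M M' : unroll M M' -> equi M M'.
Proof.
intros H; split; [intros R | intros A hA]; split.
- exact (red_unroll_inv H).
- exact (red_unroll H).
- revert A hA; induction H as [|Ms N N' H IH]; intros A hA HA; [exact HA|].
  apply IH; [exact hA|].
  inversion HA; subst; [discriminate | assumption].
- intros HA; induction H; [exact HA | now constructor; auto].
Qed.

(** A frame observes its hole only through the reducts of the hole and the answers it unrolls to.
    The wrapped term is an app or a seq, so it unrolls only to itself, which is no answer. *)
Lemma equi_wrap F M M' : equi M M' -> equi (wrap F M) (wrap F M').
Proof.
assert (half : forall M M' R, equi M M' -> red (wrap F M) R -> red (wrap F M') R).
{ clear M M'; intros M M' R [Hred Hans] H.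
  destruct F as [V|N]; apply red_inv in H; simpl in *.
  - destruct H as [[N [H ->]]|[M1 [H ->]]].
    + now apply red_beta, Hans.
    + now apply red_app, Hred.
  - destruct H as [[V [H ->]]|[[M1 [H ->]]|[o [n1 [n2 [H ->]]]]]].
    + now apply red_prd, Hans.
    + now apply red_seq, Hred.
    + now apply red_arith, Hans. }
assert (sym : forall M M', equi M M' -> equi M' M).
{ intros M1 M2 [H1 H2]; split; symmetry; auto. }
intros H; split.
- split; apply half; auto.
- intros A hA; destruct F; split; intros HA; inversion HA; now subst.
Qed.

Lemma equi_fill C M M' : equi M M' -> equi (fill C M) (fill C M').
Proof.
revert M M'; induction C as [|F C IH]; intros M M' H; [exact H|].
now apply IH, equi_wrap.
Qed.

Lemma equi_letrec Ms N :
  equi (Letrec Ms N) (inst (map (fun M => Thunk (Letrec Ms M)) Ms) N).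
Proof. apply equi_unroll; constructor; constructor. Qed.

(** * Computing [step] inside a context *)

Lemma step_some M R : red M R -> step M = Some R.
Proof. apply cbpv_stepP. Qed.

Lemma step_none M : (forall R, ~ red M R) -> step M = None.
Proof.
intros H; destruct (step M) as [R|] eqn:E; [|easy].
now apply cbpv_stepP, H in E.
Qed.

Lemma step_equi M M' : equi M M' -> step M = step M'.
Proof.
intros [H _]; destruct (step M') as [R|] eqn:E.
- now apply step_some, H, cbpv_stepP.
- apply step_none; intros R HR; apply H, cbpv_stepP in HR; congruence.
Qed.

(** A term that is neither a letrec nor an answer unrolls only to itself, so no frame can consume it
    and only the congruence rules remain. *)
Lemma step_wrap F M :
  is_letrec M = false -> answer M = false ->
  step (wrap F M) = option_map (wrap F) (step M).
Proof.
intros hl ha; destruct (step M) as [R|] eqn:E; simpl.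
- apply cbpv_stepP in E; apply step_some.
  destruct F; [now apply red_app | now apply red_seq].
- assert (HM : forall R, ~ red M R).
  { intros R HR; apply cbpv_stepP in HR; congruence. }
  apply step_none; intros R H; destruct F; apply red_inv in H; simpl in H;
    decompose [or and ex] H;
    solve [eapply HM; eassumption
          |match goal with HU : unroll _ _ |- _ => apply unroll_head in HU end;
           subst; easy].
Qed.

Lemma step_fill C M :
  is_letrec M = false -> answer M = false ->
  step (fill C M) = option_map (fill C) (step M).
Proof.
revert M; induction C as [|F C IH]; intros M hl ha; simpl.
- now destruct (step M).
- rewrite IH, step_wrap by (assumption || now destruct F).
  now destruct (step M).
Qed.

Lemma step_force V :
  step (Force V) = match V with Thunk M => Some M | _ => None end.
Proof.
destruct V; try (apply step_none; intros R H; apply red_inv in H; discriminate).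
apply step_some; constructor.
Qed.

Lemma step_if0 V M1 M2 :
  step (If0 V M1 M2) =
  match V with Nat 0 => Some M1 | Nat (S _) => Some M2 | _ => None end.
Proof.
destruct V as [x|[|n]|M];
  try (apply step_some; now constructor);
  apply step_none; intros R H; apply red_inv in H;
  now destruct H as [[H _]|[? [H _]]].
Qed.

Definition contract (F : eframe) A : option (term Op) :=
  match F, A with
  | EApp V, Lam N => Some (inst [V] N)
  | ESeq N, Prd V => Some (inst [V] N)
  | ESeq N, Arith o (Nat n1) (Nat n2) => Some (inst [Nat (interp o n1 n2)] N)
  | _, _ => None
  end.

Lemma step_wrap_answer F A : answer A = true -> step (wrap F A) = contract F A.
Proof.
intros hA; destruct (contract F A) as [R|] eqn:E.
- apply step_some; destruct F, A; try discriminate; simpl in E |- *.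
  + injection E as <-; apply red_beta; constructor.
  + injection E as <-; apply red_prd; constructor.
  + destruct V1, V2; try discriminate; injection E as <-.
    apply red_arith; constructor.
- apply step_none; intros R H; destruct F; apply red_inv in H; simpl in H;
    decompose [or and ex] H;
    match goal with
    | HU : unroll _ _ |- _ =>
        apply unroll_head in HU; [subst; discriminate | now destruct A]
    | HR : red A _ |- _ => apply red_inv in HR; now destruct A
    end.
Qed.

(** An answer has no step of its own. Together with the innermost frame it forms an app or a seq, to
    which [step_fill] applies. *)
Lemma step_answer C A :
  answer A = true ->
  step (fill C A) =
  match C with
  | [] => None
  | F :: C => option_map (fill C) (contract F A)
  end.
Proof.
intros hA; destruct C as [|F C]; simpl.
- apply step_none; intros R H; apply red_inv in H; now destruct A.
- now rewrite step_fill, step_wrap_answer by (assumption || now destruct F).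
Qed.

End Semantics.
(** * Paths and unloading *)

Section Unloading.

Variables (Op : Type) (P : term Op).
Implicit Types (p q : path) (e : env) (v : mvalue) (d : list (path * value Op)).
Implicit Types (V : value Op) (M N : term Op) (k : list frame) (a : list aframe).

(** [descend] moves only through the child positions that [root] retracts. *)
Lemma root_descend M p :
  subterm P p = Some (PTm M) -> root P (descend M p) = root P p.
Proof.
revert p; induction M as
  [x|n|M _|V _|Ms N _ IH|V _|M N IH _|V M _ IH|M _|o V1 V2 _ _|V M1 M2 _ _ _]
  using term_nested_ind with (PV := fun _ => True);
  try easy; intros p E; simpl;
  rewrite IH; simpl; now rewrite E.
Qed.

Lemma root_eta p : root P (eta P p) = root P p.
Proof.
unfold eta; destruct (subterm P p) as [[V|M]|] eqn:E; [easy | | easy].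
now apply root_descend.
Qed.

Lemma length_descend M p : length p <= length (descend M p).
Proof.
revert p; induction M as
  [x|n|M _|V _|Ms N _ IH|V _|M N IH _|V M _ IH|M _|o V1 V2 _ _|V M1 M2 _ _ _]
  using term_nested_ind with (PV := fun _ => True);
  try easy; intros p; simpl;
  (etransitivity; [|apply IH]); simpl; lia.
Qed.

(** At an app, seq or letrec, [descend] goes down at least one level and so lengthens the path. *)
Lemma eta_fixed p M :
  subterm P p = Some (PTm M) -> eta P p = p ->
  match M with App _ _ | Seq _ _ | Letrec _ _ => False | _ => True end.
Proof.
unfold eta; intros -> H; destruct M; try easy; simpl in H;
  match type of H with descend ?M ?q = _ =>
    pose proof (length_descend M q) as L end;
  rewrite H in L; simpl in L; lia.
Qed.

Lemma root_binding p Ms N j :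
  subterm P p = Some (PTm (Letrec Ms N)) -> root P (S j :: p) = S j :: p.
Proof. intros E; destruct j; simpl; now rewrite ?E. Qed.

Lemma unload_path_binding p Ms N M j d :
  subterm P p = Some (PTm (Letrec Ms N)) -> nth_error Ms j = Some M ->
  unload_path P (S j :: p) d = subst (sigma P p d) (Letrec Ms M).
Proof. intros E EM; unfold unload_path; now rewrite E, EM. Qed.

Lemma entry_aframes q : entry P q -> aframes P (root P q) = [].
Proof.
intros [[p0 [M [E ->]]]|[j [p0 [Ms [N [E [hj ->]]]]]]]; rewrite root_eta; simpl.
- now rewrite E; simpl; rewrite E.
(* Indices 1 and 2 are split off because [root] and [aframes] test them for other constructors. *)
- destruct j as [|[|[|j]]]; [lia | | | easy]; simpl; rewrite E; simpl; now rewrite ?E.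
Qed.

Lemma covers_app e l p : covers P e (l ++ p) -> covers P e p.
Proof.
intros H l' n p0 <- Hb; apply (H (l ++ l') n p0); [|exact Hb].
now rewrite app_assoc.
Qed.

Lemma covers_cons e n p : covers P e (n :: p) -> covers P e p.
Proof. exact (@covers_app e [n] p). Qed.

Lemma covers_value e n p V :
  subterm P (n :: p) = Some (PVal V) -> covers P e p -> covers P e (n :: p).
Proof.
intros E H [|m l] n0 p0 Hp Hb; simpl in Hp.
- injection Hp as -> ->; simpl in E.
  destruct Hb as [[-> [M EM]]|[-> [M [N EM]]]]; now rewrite EM in E.
- injection Hp as _ Hp; exact (H l n0 p0 Hp Hb).
Qed.

Lemma sigma_value n p V d :
  subterm P (n :: p) = Some (PVal V) -> sigma P (n :: p) d = sigma P p d.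
Proof.
simpl; destruct (subterm P p) as [[W|[]]|]; destruct n as [|[|n]]; try easy;
  unfold child; now destruct (nth_error _ _).
Qed.

Lemma lookup_unload e p :
  lookup (unload_env P e) p = option_map (unload_value P) (lookup e p).
Proof.
unfold lookup; induction e as [|[q v] e IH]; [easy|]; simpl.
now destruct (list_eq_dec Nat.eq_dec q p).
Qed.

Lemma lookup_cons_eq (A : Type) (x : A) (d : list (path * A)) p :
  lookup ((p, x) :: d) p = Some x.
Proof. unfold lookup; simpl; now destruct list_eq_dec. Qed.

Lemma lookup_cons_neq (A : Type) (x : A) (d : list (path * A)) p q :
  p <> q -> lookup ((p, x) :: d) q = lookup d q.
Proof. intros H; unfold lookup; simpl; now destruct list_eq_dec. Qed.

(** * Operands *)

(** The fact about jump targets that the force case uses: by [entry_aframes], no argument frames are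
    pending there. *)
Definition entry_value v : Prop := forall q e, v = MClos q e -> entry P q.

Lemma wf_entry_value v : wf_value P v -> entry_value v.
Proof. intros H q e ->; now inversion H. Qed.

(** [resolve] and [sigma] climb the same path and discard the same binders, so induction on the path
    compares them binder by binder. *)
Lemma eval_resolve e q x :
  covers P e q -> wf_env P e ->
  exists v, eval e (resolve P q x) = Some v /\ entry_value v /\
            unload_value P v = sigma P q (unload_env P e) x.
Proof.
intros Hc He; revert x; induction q as [|n q IH]; intros x.
{ now exists (MVar x). }
specialize (IH (covers_cons Hc)).
assert (binder :
  (n = 0 /\ exists M, subterm P q = Some (PTm (Lam M))) \/
  (n = 1 /\ exists M N, subterm P q = Some (PTm (Seq M N))) ->
  exists v,
    eval e (match x with 0 => LOC q | S y => resolve P q y end) = Some v /\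
    entry_value v /\
    unload_value P v =
    extend [match lookup (unload_env P e) q with Some V => V | None => Nat 0 end]
      (sigma P q (unload_env P e)) x).
{ intros Hb; destruct x as [|y].
  - destruct (Hc [] n q eq_refl Hb) as [v Hv]; exists v; split; [exact Hv|].
    rewrite lookup_unload, Hv; split; [exact (wf_entry_value (He _ _ Hv)) | easy].
  - rewrite extend_cons_S; apply IH. }
assert (letrec : forall Ms N, subterm P q = Some (PTm (Letrec Ms N)) ->
  exists v,
    eval e (if x <? length Ms then LBL (eta P (S x :: q))
            else resolve P q (x - length Ms)) = Some v /\
    entry_value v /\
    unload_value P v =
    extend (map (fun M => Thunk (subst (sigma P q (unload_env P e)) (Letrec Ms M))) Ms)
      (sigma P q (unload_env P e)) x).
{ intros Ms N E; destruct (Nat.ltb_spec x (length Ms)) as [hx|hx].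
  - eexists; split; [reflexivity|]; split.
    (* Child 0 of a letrec is its body, so the variable with index [x] belongs to child [S x]. *)
    + intros q' e' [= <- <-]; right; exists (S x), q, Ms, N; repeat split; try easy; lia.
    + destruct (nth_error Ms x) as [M|] eqn:EM; [|apply nth_error_None in EM; lia].
      unfold extend; rewrite nth_error_map, EM.
      cbn [option_map unload_value].
      rewrite root_eta, (root_binding _ E).
      now rewrite (unload_path_binding _ E EM).
  - destruct (IH (x - length Ms)) as [v [Hv [Hw Hu]]]; exists v.
    split; [exact Hv|]; split; [exact Hw|]; rewrite Hu; unfold extend.
    rewrite (proj2 (nth_error_None _ x)), length_map; [easy|].
    now rewrite length_map. }
simpl; destruct n as [|[|n]], (subterm P q) as [[V|[]]|] eqn:E;
  try (now apply IH); try (eapply letrec; reflexivity);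
  apply binder; eauto 6.
Qed.

(** A value child lies under no binder of its parent, so [sigma] may be taken at the parent [p],
    where the unloaded term applies it. *)
Lemma eval_gamma e n p V :
  subterm P (n :: p) = Some (PVal V) -> covers P e p -> wf_env P e ->
  exists v, eval e (gamma P (n :: p)) = Some v /\ entry_value v /\
            unload_value P v = subst_value (sigma P p (unload_env P e)) V.
Proof.
intros E Hc He; rewrite <- (sigma_value _ E); unfold gamma.
pose proof (covers_value E Hc) as Hc'; revert E Hc'; generalize (n :: p) as q.
intros q E Hc'; rewrite E; destruct V as [x|m|M]; simpl.
- now apply eval_resolve.
- now exists (MNat m).
- eexists; split; [reflexivity|]; split.
  + intros q' e' [= <- <-]; left; now exists q, M.
  + simpl; rewrite root_eta; simpl; rewrite E; unfold unload_path, unload_at.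
    simpl; now rewrite E.
Qed.

(** * Contexts *)

Definition fpath (x : aframe) : path := match x with ARG q | SEQ q => q end.

(** Lets an induction over argument frames pass from [p] to the path of the first frame, a proper
    suffix of [p]. *)
Lemma aframes_cons p x a :
  aframes P p = x :: a ->
  a = aframes P (fpath x) /\ (exists l n, p = l ++ n :: fpath x) /\
  match x with
  | ARG q => exists V M, subterm P q = Some (PTm (App V M))
  | SEQ q => exists M N, subterm P q = Some (PTm (Seq M N))
  end.
Proof.
(* On the length of [p]: popping the frame [ARG q] at a lambda jumps to [q]. *)
remember (length p) as m eqn:Hm; assert (L : length p <= m) by lia; clear Hm.
revert p x a L; induction m as [|m IH]; intros [|n p] x a L H; try easy.
assert (keep : aframes P p = x :: a ->
  a = aframes P (fpath x) /\ (exists l i, n :: p = l ++ i :: fpath x) /\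
  match x with
  | ARG q => exists V M, subterm P q = Some (PTm (App V M))
  | SEQ q => exists M N, subterm P q = Some (PTm (Seq M N))
  end).
{ intros H'; simpl in L; apply IH in H' as [Ha [[l [i ->]] Hx]]; [|lia].
  split; [exact Ha|]; split; [now exists (n :: l), i | exact Hx]. }
simpl in H; destruct n as [|[|[|n]]], (subterm P p) as [[V|[]]|] eqn:E;
  try discriminate; try (now apply keep);
  try (injection H as <- <-; split; [easy|]; split; [now eexists [], _ | simpl; eauto]).
destruct (aframes P p) as [|[q|q] a'] eqn:Ea; [discriminate| |now apply keep].
simpl in L; apply IH in Ea as [-> [[l [i ->]] _]]; [|lia].
rewrite length_app in L; simpl in L.
apply IH in H as [Ha [[l' [i' Eq]] Hx]]; [|simpl in *; lia].
split; [exact Ha|]; split; [|exact Hx].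
simpl in Eq; rewrite Eq; exists (0 :: l ++ i :: l'), i'.
now rewrite <- app_comm_cons, <- app_assoc.
Qed.

Definition actx e (x : aframe) : eframe Op :=
  match x with
  | ARG p =>
      EApp match subterm P (0 :: p) with
           | Some (PVal V) => subst_value (sigma P p (unload_env P e)) V
           | _ => Nat 0
           end
  | SEQ p =>
      ESeq match subterm P p with
           | Some (PTm (Seq _ N)) => subst (up (sigma P p (unload_env P e))) N
           | _ => Prd (Nat 0)
           end
  end.

(** The current environment does not occur: a return frame supplies its saved one for its seq and
    for all argument frames around that seq. *)
Fixpoint kctx k : list (eframe Op) :=
  match k with
  | [] => []
  | FArg v :: k => EApp (unload_value P v) :: kctx k
  | FRet p _ e :: k => map (actx e) (SEQ p :: aframes P p) ++ kctx k
  end.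

Lemma plug_args_fill M e a : plug_args P M e a = fill (map (actx e) a) M.
Proof. revert M; now induction a as [|[p|p] a IH]; intros M; simpl. Qed.

Lemma plug_fill M e a k : plug P M e a k = fill (map (actx e) a ++ kctx k) M.
Proof.
revert M e a; induction k as [|[v|p p' e'] k IH]; intros M e a; simpl;
  rewrite fill_app, ?IH, plug_args_fill; reflexivity.
Qed.

(** * Unloading and environment updates *)

Lemma unload_eta r e k :
  root P r = r ->
  unload P (State (eta P r) e k) =
  fill (map (actx e) (aframes P r) ++ kctx k) (unload_path P r (unload_env P e)).
Proof. intros E; simpl; now rewrite root_eta, E, plug_fill. Qed.

(** [sigma] at [q] looks up only proper suffixes of [q], which are shorter than [p]. *)
Lemma sigma_update e p v q :
  length q <= length p ->
  sigma P q (unload_env P (update e p v)) = sigma P q (unload_env P e).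
Proof.
induction q as [|n q IH]; intros L; [easy|]; simpl in L |- *.
assert (E : lookup ((p, unload_value P v) :: unload_env P e) q =
            lookup (unload_env P e) q).
{ apply lookup_cons_neq; intros ->; lia. }
unfold unload_env, update in *; simpl in *.
now rewrite E, IH by lia.
Qed.

(** The bound allows [q] to be a child of [p], where the machine continues after an update at [p].
    Frames of [q] sit at proper suffixes of [q], hence are no longer than [p]. *)
Lemma actx_update e p v q :
  length q <= S (length p) ->
  map (actx (update e p v)) (aframes P q) = map (actx e) (aframes P q).
Proof.
remember (aframes P q) as a eqn:E; symmetry in E; revert q E.
induction a as [|x a IH]; intros q E L; [easy|]; cbn [map].
destruct (aframes_cons E) as [Ea [[l [n Eq]] _]].
rewrite Eq, length_app in L; simpl in L.
f_equal; [|apply (IH (fpath x)); [easy | lia]].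
destruct x as [q'|q']; simpl in L; unfold actx; now rewrite sigma_update by lia.
Qed.

Lemma sigma_letrec p Ms N n d :
  subterm P p = Some (PTm (Letrec Ms N)) ->
  sigma P (n :: p) d =
  extend (map (fun M => Thunk (subst (sigma P p d) (Letrec Ms M))) Ms) (sigma P p d).
Proof. intros E; simpl; rewrite E; now destruct n as [|[|n]]. Qed.

(** * Moving from root(p) down to p *)

Variable interp : Op -> nat -> nat -> nat.

Notation equi := (equi interp).

Lemma equi_letrec_subst Ms M (s : substitution Op) :
  equi (subst s (Letrec Ms M))
       (subst (extend (map (fun M => Thunk (subst s (Letrec Ms M))) Ms) s) M).
Proof.
simpl; eapply equi_trans; [apply equi_letrec|].
rewrite map_map, <- inst_subst, length_map; apply equi_refl.
Qed.

(** The two terms differ only at a letrec binding, where [unload_path] rebuilds the letrec around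
    it; one unrolling removes it again. *)
Lemma equi_unload_path p M d :
  subterm P p = Some (PTm M) ->
  equi (unload_path P p d) (subst (sigma P p d) M).
Proof.
intros E.
assert (same : unload_at P p d = subst (sigma P p d) M).
{ unfold unload_at; now rewrite E. }
destruct p as [|[|j] p0]; cbn [unload_path];
  [rewrite same; apply equi_refl..|].
destruct (subterm P p0) as [[V|[]]|] eqn:E0; try (rewrite same; apply equi_refl).
rewrite (sigma_letrec _ _ E0).
simpl in E; rewrite E0 in E; unfold child in E.
destruct (nth_error Ms j) as [M'|]; [injection E as -> | discriminate].
apply equi_letrec_subst.
Qed.

Lemma equi_root p M e K :
  subterm P p = Some (PTm M) ->
  equi (fill (map (actx e) (aframes P (root P p)) ++ K)
          (unload_path P (root P p) (unload_env P e)))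
       (fill (map (actx e) (aframes P p) ++ K)
          (subst (sigma P p (unload_env P e)) M)).
Proof.
revert M; induction p as [|n p IH]; intros M E.
{ now apply equi_fill, equi_unload_path. }
assert (stop : root P (n :: p) = n :: p ->
  equi (fill (map (actx e) (aframes P (root P (n :: p))) ++ K)
          (unload_path P (root P (n :: p)) (unload_env P e)))
       (fill (map (actx e) (aframes P (n :: p)) ++ K)
          (subst (sigma P (n :: p) (unload_env P e)) M))).
{ intros ->; now apply equi_fill, equi_unload_path. }
destruct (subterm P p) as [t|] eqn:Ep; [|simpl in E; now rewrite Ep in E].
destruct t as [V|[V|Ms N|V|M1 M2|V M1|M1|o V1 V2|V M1 M2]];
  try (apply stop; simpl; rewrite Ep; now destruct n as [|[|n]]).
- destruct n as [|j]; [|now apply stop, root_binding with Ms N].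
  simpl in E; rewrite Ep in E; injection E as <-.
  rewrite (sigma_letrec _ _ Ep); simpl; rewrite Ep.
  eapply equi_trans; [exact (IH _ eq_refl) | apply equi_fill, equi_letrec_subst].
(* For child 0 of a seq, and below for child 1 of an app, filling the new innermost frame rebuilds
   the term at [p], so the induction hypothesis fits by conversion. *)
- destruct n as [|[|n]]; try (apply stop; simpl; now rewrite ?Ep).
  simpl in E; rewrite Ep in E; injection E as <-.
  simpl; rewrite Ep; simpl; rewrite Ep; exact (IH _ eq_refl).
- destruct n as [|[|n]]; try (apply stop; simpl; now rewrite ?Ep).
  simpl in E; rewrite Ep in E; injection E as <-.
  simpl; rewrite Ep; simpl; rewrite Ep; exact (IH _ eq_refl).
Qed.

(** * Unloading the stacks and successor states of the machine *)

Lemma actx_arg e q V M :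
  subterm P q = Some (PTm (App V M)) ->
  actx e (ARG q) = EApp (subst_value (sigma P q (unload_env P e)) V).
Proof. intros E; simpl; now rewrite E. Qed.

Lemma actx_seq e q M N :
  subterm P q = Some (PTm (Seq M N)) ->
  actx e (SEQ q) = ESeq (subst (up (sigma P q (unload_env P e))) N).
Proof. intros E; simpl; now rewrite E. Qed.

(** Arguments before the first [SEQ] become stack frames holding their values. That [SEQ] and
    everything beyond it are what [kctx] reads off a return frame for it. *)
Lemma eval_args e p :
  covers P e p -> wf_env P e ->
  let (os, r) := args P p in
  exists fs, delta e os = Some fs /\
    forall k, map (actx e) (aframes P p) ++ kctx k =
      kctx (fs ++ match r with
                 | None => k
                 | Some q => FRet q (eta P (1 :: q)) e :: k
                 end).
Proof.
intros Hc He; unfold args; remember (aframes P p) as a eqn:E; symmetry in E.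
revert p E Hc; induction a as [|[q|q] a IH]; intros p E Hc.
- now exists [].
- destruct (aframes_cons E) as [Ea [[l [n ->]] [V [M Eq]]]]; simpl in Ea, Eq, Hc.
  apply covers_app, covers_cons in Hc.
  specialize (IH q (eq_sym Ea) Hc); cbn [args_of].
  destruct (args_of P a) as [os r]; destruct IH as [fs [Hfs Hk]].
  assert (E0 : subterm P (0 :: q) = Some (PVal V)) by (simpl; now rewrite Eq).
  destruct (eval_gamma E0 Hc He) as [v [Hv [_ Hu]]].
  exists (FArg v :: fs); cbn [delta]; rewrite Hv, Hfs; split; [easy|]; intros k.
  cbn [map app kctx]; now rewrite (actx_arg _ Eq), Hk, Hu.
- destruct (aframes_cons E) as [Ea _]; simpl in Ea.
  exists []; split; [easy|]; intros k; cbn [app kctx]; now rewrite Ea.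
Qed.

Lemma sigma_bind e p v n :
  (n = 0 /\ exists M, subterm P p = Some (PTm (Lam M))) \/
  (n = 1 /\ exists M N, subterm P p = Some (PTm (Seq M N))) ->
  sigma P (n :: p) (unload_env P (update e p v)) =
  extend [unload_value P v] (sigma P p (unload_env P e)).
Proof.
intros Hb; rewrite <- (sigma_update e v (le_n (length p))).
simpl; rewrite lookup_cons_eq.
now destruct Hb as [[-> [M E]]|[-> [M [N E]]]]; rewrite E.
Qed.

(** Serves both ways of binding a result: [e] is the current environment when the seq is in the
    argument frames, and the saved one when returning through the stack. *)
Lemma unload_seq q M N e v k :
  subterm P q = Some (PTm (Seq M N)) ->
  unload P (State (eta P (1 :: q)) (update e q v) k) =
  fill (map (actx e) (aframes P q) ++ kctx k)
    (inst [unload_value P v] (subst (up (sigma P q (unload_env P e))) N)).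
Proof.
intros E; rewrite unload_eta by (simpl; now rewrite E).
rewrite actx_update by easy.
cbn [unload_path]; unfold unload_at; rewrite sigma_bind by eauto 6.
rewrite inst_subst1; simpl; now rewrite E.
Qed.

Lemma unload_lam p M e v k :
  subterm P p = Some (PTm (Lam M)) ->
  unload P (State (eta P (0 :: p)) (update e p v) k) =
  fill (map (actx e) (aframes P (0 :: p)) ++ kctx k)
    (inst [unload_value P v] (subst (up (sigma P p (unload_env P e))) M)).
Proof.
intros E; rewrite unload_eta by (simpl; now rewrite E).
rewrite actx_update by easy.
cbn [unload_path]; unfold unload_at; rewrite sigma_bind by eauto 6.
rewrite inst_subst1; simpl; now rewrite E.
Qed.

Lemma unload_if0 p i V M1 M2 M e k :
  subterm P p = Some (PTm (If0 V M1 M2)) -> i = 1 \/ i = 2 ->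
  subterm P (i :: p) = Some (PTm M) ->
  unload P (State (eta P (i :: p)) e k) =
  fill (map (actx e) (aframes P p) ++ kctx k)
    (subst (sigma P p (unload_env P e)) M).
Proof.
intros E hi EM; rewrite unload_eta by (destruct hi as [-> | ->]; simpl; now rewrite ?E).
assert (Ea : aframes P (i :: p) = aframes P p).
{ destruct hi as [-> | ->]; simpl; now rewrite E. }
assert (Es : forall d, sigma P (i :: p) d = sigma P p d).
{ intros d; destruct hi as [-> | ->]; simpl; now rewrite E. }
rewrite Ea, <- Es; unfold unload_path, unload_at; rewrite EM.
now destruct hi as [-> | ->]; rewrite E.
Qed.

End Unloading.

(** * One step of the machine *)

Section Simulation.

Variables (Op : Type) (interp : Op -> nat -> nat -> nat) (P : term Op).
Variables (p : path) (e : env) (k : list frame).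
Hypotheses (Hc : covers P e p) (He : wf_env P e) (Hk : Forall (wf_frame P) k).

Notation step := (cbpv_step interp).
Notation machine_step := (cfg_step interp (compile P)).
Notation sub := (subst (sigma P p (unload_env P e))).
Notation subv := (subst_value (sigma P p (unload_env P e))).
Notation ctx := (map (actx P e) (aframes P p) ++ kctx P k).

Lemma simulation_force V :
  subterm P p = Some (PTm (Force V)) ->
  step (fill ctx (Force (subv V))) = option_map (unload P) (machine_step (State p e k)).
Proof.
intros E; rewrite step_fill, step_force by easy.
assert (E0 : subterm P (0 :: p) = Some (PVal V)) by (simpl; now rewrite E).
destruct (eval_gamma E0 Hc He) as [v [Hv [Hw Hu]]]; rewrite <- Hu.
pose proof (eval_args Hc He) as Ha; unfold cfg_step, compile; rewrite E.
destruct (args P p) as [os r]; destruct Ha as [fs [Hfs Hctx]].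
(* The entered path has no argument frames, so the pushed stack has to account for the whole
   context. *)
assert (enter : forall q' e', v = MClos q' e' ->
  unload P (State q' e' (fs ++ match r with
                               | None => k
                               | Some q => FRet q (eta P (1 :: q)) e :: k
                               end)) =
  fill ctx (unload_path P (root P q') (unload_env P e'))).
{ intros q' e' Eq; unfold unload.
  now rewrite (entry_aframes (Hw _ _ Eq)), plug_fill, Hctx. }
destruct r as [q|]; rewrite Hv, Hfs; destruct v as [x|n|q' e']; try easy;
  simpl option_map; f_equal; symmetry; now apply enter.
Qed.

Lemma simulation_if0 V M1 M2 :
  subterm P p = Some (PTm (If0 V M1 M2)) ->
  step (fill ctx (If0 (subv V) (sub M1) (sub M2))) =
  option_map (unload P) (machine_step (State p e k)).
Proof.
intros E; rewrite step_fill, step_if0 by easy.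
assert (E0 : subterm P (0 :: p) = Some (PVal V)) by (simpl; now rewrite E).
destruct (eval_gamma E0 Hc He) as [v [Hv [_ Hu]]]; rewrite <- Hu.
unfold cfg_step, compile; rewrite E, Hv.
destruct v as [x|[|n]|q' e']; try easy; cbn [option_map unload_value]; f_equal; symmetry;
  (eapply unload_if0; [exact E | auto | simpl; now rewrite E]).
Qed.

Lemma simulation_prd V :
  subterm P p = Some (PTm (Prd V)) ->
  step (fill ctx (Prd (subv V))) = option_map (unload P) (machine_step (State p e k)).
Proof.
intros E; rewrite step_answer by easy.
assert (E0 : subterm P (0 :: p) = Some (PVal V)) by (simpl; now rewrite E).
destruct (eval_gamma E0 Hc He) as [v [Hv [_ Hu]]]; rewrite <- Hu.
unfold cfg_step, compile; rewrite E.
(* Without argument frames the consuming frame is on the stack; under an [ARG] both sides are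
   undefined. *)
destruct (aframes P p) as [|[q|q] a] eqn:Ea; [|easy|]; cbn [map app].
- rewrite Hv; destruct k as [|[w|q p' e'] k']; [easy|easy|].
  apply Forall_inv in Hk; destruct Hk as [[M [N Eq]] [-> _]].
  cbn [kctx map app]; rewrite (actx_seq _ Eq); simpl contract; cbn [option_map].
  f_equal; symmetry; exact (unload_seq _ _ _ Eq).
- destruct (aframes_cons Ea) as [-> [_ [M [N Eq]]]]; simpl in Eq.
  rewrite Hv, (actx_seq _ Eq); simpl contract; cbn [option_map].
  f_equal; symmetry; exact (unload_seq _ _ _ Eq).
Qed.

Lemma simulation_arith o V1 V2 :
  subterm P p = Some (PTm (Arith o V1 V2)) ->
  step (fill ctx (Arith o (subv V1) (subv V2))) =
  option_map (unload P) (machine_step (State p e k)).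
Proof.
intros E; rewrite step_answer by easy.
assert (E1 : subterm P (0 :: p) = Some (PVal V1)) by (simpl; now rewrite E).
assert (E2 : subterm P (1 :: p) = Some (PVal V2)) by (simpl; now rewrite E).
destruct (eval_gamma E1 Hc He) as [v1 [Hv1 [_ Hu1]]]; rewrite <- Hu1.
destruct (eval_gamma E2 Hc He) as [v2 [Hv2 [_ Hu2]]]; rewrite <- Hu2.
unfold cfg_step, compile; rewrite E.
destruct (aframes P p) as [|[q|q] a] eqn:Ea; [|easy|]; cbn [map app];
  rewrite Hv1, Hv2.
- destruct k as [|[w|q p' e'] k']; [now destruct v1, v2..|].
  apply Forall_inv in Hk; destruct Hk as [[M [N Eq]] [-> _]].
  cbn [kctx map app]; rewrite (actx_seq _ Eq).
  (* Unless both operands are numbers, both sides are undefined. *)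
  destruct v1 as [x1|n1|q1 e1], v2 as [x2|n2|q2 e2]; try easy.
  simpl contract; cbn [option_map].
  f_equal; symmetry; exact (unload_seq _ (MNat _) _ Eq).
- destruct (aframes_cons Ea) as [-> [_ [M [N Eq]]]]; simpl in Eq.
  rewrite (actx_seq _ Eq).
  destruct v1 as [x1|n1|q1 e1], v2 as [x2|n2|q2 e2]; try easy.
  simpl contract; cbn [option_map].
  f_equal; symmetry; exact (unload_seq _ (MNat _) _ Eq).
Qed.

Lemma simulation_lam M :
  subterm P p = Some (PTm (Lam M)) ->
  step (fill ctx (sub (Lam M))) = option_map (unload P) (machine_step (State p e k)).
Proof.
intros E; rewrite step_answer by easy; unfold cfg_step, compile; rewrite E.
assert (Ebody : aframes P (0 :: p) =
  match aframes P p with ARG _ :: a => a | a => a end) by (simpl; now rewrite E).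
(* The argument comes from the stack or from an [ARG] frame, which [aframes] drops for the body;
   under a [SEQ] both sides are undefined. *)
destruct (aframes P p) as [|[q|q] a] eqn:Ea; [| |easy]; cbn [map app].
- destruct k as [|[w|q p' e'] k']; [easy| |easy].
  cbn [kctx option_map]; rewrite (unload_lam _ _ _ E), Ebody; reflexivity.
- destruct (aframes_cons Ea) as [_ [[l [n Ep]] [V [N Eq]]]]; simpl in Ep, Eq.
  (* The argument occurs at [0 :: q], outside the lambda at [p], but is evaluated in the environment
     of [p]. *)
  assert (Hq : covers P e q).
  { rewrite Ep in Hc; exact (covers_cons (covers_app Hc)). }
  assert (E0 : subterm P (0 :: q) = Some (PVal V)) by (simpl; now rewrite Eq).
  destruct (eval_gamma E0 Hq He) as [v [Hv [_ Hu]]].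
  rewrite Hv, (actx_arg _ Eq), <- Hu; cbn [option_map].
  rewrite (unload_lam _ _ _ E), Ebody; reflexivity.
Qed.

End Simulation.

Theorem theorem4p1 (Op : Type) (interp : Op -> nat -> nat -> nat)
  (P : term Op) (s : state) (wf_s : wf_state P s) :
  cbpv_step interp (unload P s) = option_map (unload P) (cfg_step interp (compile P) s).
Proof.
destruct s as [p e k]; destruct wf_s as [[M E] [Heta [Hc [He Hk]]]].
rewrite <- Heta at 1; unfold unload at 1; rewrite root_eta, plug_fill.
rewrite (step_equi (equi_root interp e (kctx P k) E)).
pose proof (eta_fixed E Heta) as Hhead; destruct M; try easy.
- now apply simulation_force.
- now apply simulation_prd.
- now apply simulation_lam.
- now apply simulation_arith.
- now apply simulation_if0.
Qed.
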